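(* If $q\ge 7$ is an integer, then $\operatorname{achr}(K_6\square K_q)\le 2q+6$.
   Context: For a finite simple graph $G$, $\operatorname{achr}(G)$ (the achromatic number) is the maximum number of colours in a proper vertex colouring of $G$ that is complete, i.e. every pair of distinct colours appears on the two ends of some edge. $K_6\square K_q$ is the Cartesian product of the complete graphs $K_6$ and $K_q$ (vertex set $[1,6]\times[1,q]$, two vertices adjacent iff they agree in exactly one coordinate). *)

(* Defs.v *)
From mathcomp Require Import all_boot.

Set Implicit Arguments.
Unset Strict Implicit.
Unset Printing Implicit Defensive.

Record sgraph := SGraph {
  vertex : finType;
  adj : rel vertex;
  adj_sym : symmetric adj;
  adj_irrefl : irreflexive adj }.

Definition complete_rel (n : nat) : rel 'I_n := fun x y => x != y.

Lemma complete_rel_sym n : symmetric (@complete_rel n).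
Proof. by move=> x y; rewrite /complete_rel eq_sym. Qed.

Lemma complete_rel_irrefl n : irreflexive (@complete_rel n).
Proof. by move=> x; rewrite /complete_rel eqxx. Qed.

Definition complete_graph (n : nat) : sgraph :=
  SGraph (@complete_rel_sym n) (@complete_rel_irrefl n).

Definition cart_rel (G H : sgraph) : rel (vertex G * vertex H) :=
  fun u v => ((u.1 == v.1) && adj u.2 v.2) || ((u.2 == v.2) && adj u.1 v.1).

Lemma cart_rel_sym G H : symmetric (@cart_rel G H).
Proof.
move=> u v; rewrite /cart_rel (eq_sym u.1) (eq_sym u.2).
by rewrite (adj_sym u.1) (adj_sym u.2).
Qed.

Lemma cart_rel_irrefl G H : irreflexive (@cart_rel G H).
Proof. by move=> u; rewrite /cart_rel !adj_irrefl !andbF. Qed.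

Definition cart_prod (G H : sgraph) : sgraph :=
  SGraph (@cart_rel_sym G H) (@cart_rel_irrefl G H).

Lemma adj_cart_complete m n
    (u v : vertex (cart_prod (complete_graph m) (complete_graph n))) :
  adj u v = (u.1 == v.1) (+) (u.2 == v.2).
Proof. by rewrite /= /cart_rel /= /complete_rel; do 2!case: eqP. Qed.

Section Colouring.

Variable G : sgraph.

Definition proper_colouring (C : finType) (f : {ffun vertex G -> C}) : bool :=
  [forall u, forall v, adj u v ==> (f u != f v)].

Definition complete_colouring (C : finType) (f : {ffun vertex G -> C}) : bool :=
  [forall i, forall j, (i != j) ==>
    [exists u, exists v, [&& adj u v, f u == i & f v == j]]].

(* The surjectivity clause makes k the number of colours actually used;
   completeness alone does not imply it when k = 1. *)
Definition has_complete_colouring (k : nat) : bool :=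
  [exists f : {ffun vertex G -> 'I_k},
    [&& [forall i, exists v, f v == i],
        proper_colouring f & complete_colouring f]].

(* Surjectivity forces k <= #|vertex G|, so the range below loses nothing;
   see leq_achr and achr_attained. *)
Definition achr : nat :=
  \max_(k < #|vertex G|.+1 | has_complete_colouring k) k.

Lemma leq_achr k : has_complete_colouring k -> k <= achr.
Proof.
move=> hk; have lek : k < #|vertex G|.+1.
  case/existsP: hk => f /and3P[/forallP fs _ _].
  rewrite ltnS -[k in k <= _]card_ord.
  have sub : 'I_k \subset codom f.
    by apply/subsetP => i _; have /existsP[v /eqP <-] := fs i; apply: codom_f.
  by rewrite (leq_trans (subset_leq_card sub)) // leq_image_card.
exact: (@leq_bigmax_cond _ _ (fun i : 'I_ _ => val i) (Ordinal lek)).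
Qed.

Lemma ex_complete_colouring : exists k, has_complete_colouring k.
Proof.
pose id0 : {ffun vertex G -> vertex G} := [ffun v => v].
have proper0 : proper_colouring id0.
  apply/forallP => u; apply/forallP => v; apply/implyP => uv; rewrite !ffunE.
  by apply/eqP => E; rewrite E adj_irrefl in uv.
case: (arg_minnP (fun f : {ffun vertex G -> vertex G} => #|f @: setT|) proper0).
move=> f pf fmin; pose A := f @: setT.
have fA v : f v \in A by apply: imset_f; rewrite inE.
have edgeA a b : a \in A -> b \in A -> a != b ->
    [exists u, exists v, [&& adj u v, f u == a & f v == b]].
  move=> aA bA ab; apply: contraT => no.
  have noab u v : adj u v -> f u = a -> f v = b -> False.
    move=> uv fu fv; case/negP: no; apply/existsP; exists u; apply/existsP.
    by exists v; rewrite uv fu fv !eqxx.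
  pose g : {ffun vertex G -> vertex G} :=
    [ffun v => if f v == a then b else f v].
  have pg : proper_colouring g.
    apply/forallP => u; apply/forallP => v; apply/implyP => uv; rewrite !ffunE.
    have fuv : f u != f v by move/forallP/(_ u)/forallP/(_ v): pf; rewrite uv.
    case: (eqVneq (f u) a) => fu; case: (eqVneq (f v) a) => fv //.
    - by rewrite fu fv eqxx in fuv.
    - by apply/eqP => /esym; apply: noab uv fu.
    - by apply/eqP; apply: noab fv; rewrite adj_sym.
  suff lt_gf : #|g @: setT| < #|A| by have := fmin _ pg; rewrite leqNgt lt_gf.
  apply: proper_card.
  apply/properP; split.
    by apply/subsetP => _ /imsetP[v _ ->]; rewrite ffunE; case: ifP.
  exists a => //; apply/imsetP => -[v _]; rewrite ffunE.
  by case: eqVneq => [_ /eqP|/eqP h /esym //]; rewrite (negPf ab).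
exists #|A|; apply/existsP.
case: (pickP (mem A)) => [a0 a0A|A0]; last first.
  have noV (v : vertex G) : False by have := A0 (f v); rewrite /= fA.
  have noI (i : 'I_#|A|) : False by have := enum_valP i; have /= -> := A0 (enum_val i).
  exists [ffun v => False_rect _ (noV v)].
  by apply/and3P; split; apply/forallP => x; [case: (noI x)|case: (noV x)|case: (noI x)].
pose h : {ffun vertex G -> 'I_#|A|} := [ffun v => enum_rank_in a0A (f v)].
have hE v : enum_val (h v) = f v by rewrite ffunE enum_rankK_in.
exists h; apply/and3P; split.
- apply/forallP => i; have /imsetP[v _ iv] := enum_valP i.
  by apply/existsP; exists v; apply/eqP/enum_val_inj; rewrite hE.
- apply/forallP => u; apply/forallP => v; apply/implyP => uv.
  have fuv : f u != f v by move/forallP/(_ u)/forallP/(_ v): pf; rewrite uv.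
  by apply: contraNneq fuv => E; rewrite -!hE E.
- apply/forallP => i; apply/forallP => j; apply/implyP => ij.
  have nij : enum_val i != enum_val j by rewrite (inj_eq enum_val_inj).
  have /existsP[u /existsP[v /and3P[uv /eqP fu /eqP fv]]] :=
    edgeA _ _ (enum_valP i) (enum_valP j) nij.
  apply/existsP; exists u; apply/existsP; exists v; rewrite uv /=.
  by apply/andP; split; apply/eqP/enum_val_inj; rewrite hE.
Qed.

Lemma achr_attained : has_complete_colouring achr.
Proof.
have [k hk] := ex_complete_colouring.
have lek : k < #|vertex G|.+1.
  rewrite ltnS (leq_trans (leq_achr hk)) //; apply/bigmax_leqP => i _.
  by rewrite -ltnS.
have P0 : has_complete_colouring (Ordinal lek) by [].
by rewrite /achr (bigmax_eq_arg (Ordinal lek)) //; case: arg_maxnP.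
Qed.

End Colouring.

(* Main.v *)
Require Import Defs.
From mathcomp Require Import all_boot.
From mathcomp Require Import zify.

Set Implicit Arguments.
Unset Strict Implicit.
Unset Printing Implicit Defensive.

(** Suppose more than 2q+6 colours are used. A colour class of size l occupies
    l rows and l columns, and its neighbourhood has at most l(q+5-l) vertices;
    completeness then rules out classes of size 1, and at least 21 classes have
    size exactly 2. There are only 15 pairs of rows, so two such classes lie in
    the same two rows. Both vertices of one are then adjacent to the other, so
    the 2q+6 neighbours of the latter carry at most 2q+5 colours, and at most
    2q+6 colours are used in total. *)

Section ColourClasses.

Variables (G : sgraph) (C : finType) (f : {ffun vertex G -> C}).

Definition colour_class (i : C) : {set vertex G} := [set v | f v == i].

(** Members of [A] are not removed; for a colour class, properness keeps them out. *)
Definition nbhd (A : {set vertex G}) : {set vertex G} :=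
  [set v | [exists u in A, adj u v]].

Lemma sum_card_colour_class : \sum_i #|colour_class i| = #|vertex G|.
Proof.
rewrite -sum1_card (partition_big f xpredT) //=.
by apply: eq_bigr => i _; rewrite -sum1_card; apply: eq_bigl => v; rewrite inE.
Qed.

Lemma proper_colouringP : proper_colouring f ->
  forall u v, f u = f v -> ~~ adj u v.
Proof.
move=> /forallP/(_ _)/forallP pf u v fuv; apply/negP => uv.
by have /implyP/(_ uv) := pf u v; rewrite fuv eqxx.
Qed.

Lemma nbhd_class_disjoint (i : C) : proper_colouring f ->
  [disjoint nbhd (colour_class i) & colour_class i].
Proof.
move=> pf; rewrite disjoints_subset; apply/subsetP => v.
rewrite !inE => /existsP[u /andP[]]; rewrite inE => /eqP fu uv.
by apply: contraL uv => /eqP fv; apply: (proper_colouringP pf); rewrite fu.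
Qed.

Lemma complete_colouring_nbhd (i : C) : complete_colouring f ->
  [set~ i] \subset f @: nbhd (colour_class i).
Proof.
move=> /forallP/(_ i)/forallP cf; apply/subsetP => j; rewrite !inE eq_sym => ij.
have /implyP/(_ ij)/existsP[u /existsP[v /and3P[uv fu /eqP <-]]] := cf j.
by apply: imset_f; rewrite inE; apply/existsP; exists u; rewrite inE fu.
Qed.

Lemma complete_colouring_card (i : C) : complete_colouring f ->
  #|C| <= #|nbhd (colour_class i)|.+1.
Proof.
move=> /(complete_colouring_nbhd i)/subset_leq_card; rewrite cardsC1 => le_k.
have := leq_imset_card f (nbhd (colour_class i)); lia.
Qed.

(** All colours other than [i] occur on the neighbourhood, and a repeated colour makes its image
    strictly smaller: this saves one against [complete_colouring_card]. *)
Lemma complete_colouring_card_collision (i : C) (x y : vertex G) :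
    complete_colouring f -> x != y -> f x = f y ->
    x \in nbhd (colour_class i) -> y \in nbhd (colour_class i) ->
  #|C| <= #|nbhd (colour_class i)|.
Proof.
move=> /(complete_colouring_nbhd i)/subset_leq_card; rewrite cardsC1 => le_k.
move=> xy fxy xN yN; set N := nbhd _ in le_k xN yN *.
have : #|f @: N| < #|N|.
  rewrite ltn_neqAle leq_imset_card andbT; apply/negP => /imset_injP injf.
  by rewrite (injf _ _ xN yN fxy) eqxx in xy.
lia.
Qed.

End ColourClasses.

Section RookGraph.

Variables m n : nat.
Let G := cart_prod (complete_graph m) (complete_graph n).
Variables (C : finType) (f : {ffun vertex G -> C}).
Hypothesis properf : proper_colouring f.

Definition rows (i : C) : {set 'I_m} := [set u.1 | u in colour_class f i].
Definition columns (i : C) : {set 'I_n} := [set u.2 | u in colour_class f i].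

Lemma nonadj_rook (u v : vertex G) : ~~ adj u v -> (u.1 == v.1) = (u.2 == v.2).
Proof. by rewrite adj_cart_complete; do 2!case: eqP. Qed.

(** Vertices of one class are not adjacent, so they agree in both coordinates or in neither: a class
    is a partial transversal of the grid. *)
Lemma rook_class_inj (i : C) (u v : vertex G) :
    u \in colour_class f i -> v \in colour_class f i ->
  (u.1 == v.1 -> u = v) /\ (u.2 == v.2 -> u = v).
Proof.
rewrite !inE => /eqP fu /eqP fv.
have /nonadj_rook E : ~~ adj u v by apply: (proper_colouringP properf); rewrite fu.
case: u v E {fu fv} => [a b] [c d] /= E.
split=> h; have := h; first rewrite E; last rewrite -E.
  by move: h => /eqP -> /eqP ->.
by move: h => /eqP -> /eqP ->.
Qed.

Lemma card_rows (i : C) : #|rows i| = #|colour_class f i|.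
Proof.
apply: card_in_imset => u v ui vi /eqP uv.
by apply: (proj1 (rook_class_inj ui vi)).
Qed.

Lemma card_columns (i : C) : #|columns i| = #|colour_class f i|.
Proof.
apply: card_in_imset => u v ui vi /eqP uv.
by apply: (proj2 (rook_class_inj ui vi)).
Qed.

(* The class and its neighbourhood together lie in the union of the l rows and
   l columns of the class, which has l * n + m * l - l ^ 2 vertices. *)
Lemma card_nbhd_class (i : C) (l := #|colour_class f i|) :
  #|nbhd (colour_class f i)| + l + l * l <= l * n + m * l.
Proof.
pose X := setX (rows i) [set: 'I_n]; pose Y := setX [set: 'I_m] (columns i).
have sub : nbhd (colour_class f i) :|: colour_class f i \subset X :|: Y.
  apply/subsetP => v /setUP[|vi]; last first.
    by rewrite !inE (imset_f (fun u : vertex G => u.1) vi).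
  rewrite inE => /existsP[u /andP[ui]]; rewrite adj_cart_complete => uv.
  have u1 : u.1 \in rows i by apply: imset_f.
  have u2 : u.2 \in columns i by apply: imset_f.
  move: uv; case: eqP => [E _|_ /= /eqP E].
    by rewrite !inE -E u1.
  by rewrite !inE -E u2 orbT.
have XY : X :&: Y = setX (rows i) (columns i).
  by apply/setP => -[a b]; rewrite !inE andbT.
(* Inclusion-exclusion: [X] and [Y] meet where a row and a column of the class cross. *)
have <- : #|X :|: Y| + l * l = l * n + m * l.
  have <- : #|X :&: Y| = l * l by rewrite XY cardsX card_rows card_columns.
  by rewrite cardsUI !cardsX !cardsT !card_ord card_rows card_columns.
rewrite leq_add2r; apply: leq_trans (subset_leq_card sub).
rewrite cardsU (disjoint_setI0 (nbhd_class_disjoint _ properf)) cards0.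
by rewrite subn0.
Qed.

(** Each vertex of class [j] shares its row with a vertex of class [i]; the colours differ, hence so
    do the vertices, and they are adjacent. *)
Lemma same_rows_nbhd (i j : C) : i != j -> rows j \subset rows i ->
  colour_class f j \subset nbhd (colour_class f i).
Proof.
move=> ij /subsetP sub; apply/subsetP => v vj.
have /imsetP[u ui uv] : v.1 \in rows i by apply/sub/imset_f.
rewrite inE; apply/existsP; exists u; rewrite ui adj_cart_complete uv eqxx /=.
apply: contraNN ij => /eqP uv2; move: ui vj; rewrite !inE.
have -> : u = v by case: (u) (v) uv uv2 => [? ?] [? ?] /= -> ->.
by move=> /eqP <- /eqP <-.
Qed.

End RookGraph.

Lemma complete_colouring_rook6 (q k : nat)
    (f : {ffun vertex (cart_prod (complete_graph 6) (complete_graph q)) -> 'I_k}) :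
    0 < q -> (forall i, exists v, f v = i) ->
    proper_colouring f -> complete_colouring f ->
  k <= 2 * q + 6.
Proof.
move=> q0 surjf pf cf; rewrite leqNgt; apply/negP => lt_k.
have size_ge2 i : 1 < #|colour_class f i|.
  have : 0 < #|colour_class f i|.
    have [v fv] := surjf i.
    by rewrite card_gt0; apply/set0Pn; exists v; rewrite inE fv.
  have := card_nbhd_class pf i; have := complete_colouring_card i cf.
  (* A class of size 1 has at most q + 4 neighbours, so k <= q + 5, against [lt_k]. *)
  rewrite card_ord; case: #|colour_class f i| => [|[|l]] //; lia.
pose D := [set i | #|colour_class f i| == 2].
(* Each class has size at least 3, or size 2 and then counts once more in [D]; the sizes add up to
   6q. As k >= 2q + 7, [D] has at least 21 elements. *)
have cardD : 3 * k <= 6 * q + #|D|.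
  have -> : 6 * q = \sum_i #|colour_class f i|.
    by rewrite sum_card_colour_class card_prod !card_ord.
  rewrite -sum1_card [X in _ + X]big_mkcond -big_split /= mulnC.
  rewrite -[k in k * 3]card_ord -sum_nat_const; apply: leq_sum => i _.
  by rewrite inE; have := size_ge2 i; case: #|colour_class f i| => [|[|[|l]]].
have [injD|] := boolP [forall i in D, forall j in D,
    (rows f i == rows f j) ==> (i == j)].
  (* [rows f] embeds [D] into the 15 pairs of rows, too few for 21 classes. *)
  have : #|D| <= 'C(6, 2).
    rewrite -{1}[6]card_ord -card_draws.
    rewrite -(@card_in_imset _ _ (rows f) D).
      apply: subset_leq_card; apply/subsetP => _ /imsetP[i iD ->].
      by move: iD; rewrite !inE card_rows.
    move=> i j iD jD /eqP E; apply/eqP.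
    have /forall_inP/(_ i iD)/forall_inP/(_ j jD)/implyP := injD; exact.
  have -> : 'C(6, 2) = 15 by [].
  lia.
rewrite negb_forall => /existsP[i]; rewrite negb_imply => /andP[iD].
rewrite negb_forall => /existsP[j]; rewrite !negb_imply => /and3P[jD /eqP E ij].
have /subsetP sub : colour_class f j \subset nbhd (colour_class f i).
  by apply: same_rows_nbhd => //; rewrite E.
have : 1 < #|colour_class f j| by [].
move=> /card_gt1P[x [y [xj yj xy]]].
have fxy : f x = f y by move: xj yj; rewrite !inE => /eqP -> /eqP ->.
have := complete_colouring_card_collision cf xy fxy (sub _ xj) (sub _ yj).
(* For l = 2 the neighbourhood has at most 2(q + 6) - 2 - 4 = 2q + 6 vertices. *)
have := card_nbhd_class pf i; move: iD; rewrite inE => /eqP ->.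
rewrite card_ord; lia.
Qed.

Theorem lemma12 (q : nat) (hq : 7 <= q) :
  achr (cart_prod (complete_graph 6) (complete_graph q)) <= 2 * q + 6.
Proof.
have /existsP[f /and3P[/forallP surjf pf cf]] :=
  achr_attained (cart_prod (complete_graph 6) (complete_graph q)).
apply: complete_colouring_rook6 pf cf; first by case: q hq {f surjf}.
by move=> i; have /existsP[v /eqP] := surjf i; exists v.
Qed.
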